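(* For any $2k$-gon $P\in\mathcal{P}(k)$ there exists an $n$-vertex graph $G\in P_{hom}$ with $\Omega(n^{k(1-\epsilon)})$ maximal cliques, for any $\epsilon>0$. Moreover, if $k$ is a constant, then the bound is $\Omega(n^{k})$.
   Context: A polygon means a closed convex polygon in the plane. $\mathcal{P}(k)$ is the family of all polygons $P$ for which there exist $k$ distinct lines through the origin such that every side of $P$ is parallel to one of these lines; thus a $2k$-gon in $\mathcal{P}(k)$ has $k$ pairs of parallel sides. For a collection of sets, its intersection graph has one vertex for each member of the collection, and two distinct vertices are adjacent if and only if the corresponding sets have nonempty intersection. Two sets are homothetic if one of them can be obtained from the other by scaling and/or translating. $P_{hom}$ is the class of intersection graphs of collections of sets homothetic to $P$. Maximal cliques are maximal with respect to inclusion. *)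

(* Defs.v *)
From HB Require Import structures.
From mathcomp Require Import all_boot all_order all_algebra.
From mathcomp Require Import all_classical all_reals all_analysis.

Set Implicit Arguments.
Unset Strict Implicit.
Unset Printing Implicit Defensive.

Import Order.TTheory GRing.Theory Num.Theory.
Import numFieldNormedType.Exports.

Local Open Scope classical_set_scope.
Local Open Scope ring_scope.

Notation plane R := 'rV[R]_2.

Section Polygons.
Context {R : realType}.
Implicit Types (P Q S L : set (plane R)) (a x y v t : plane R).

Definition dot a x : R := \sum_i a 0 i * x 0 i.

Definition halfplane a (b : R) : set (plane R) := [set x | dot a x <= b].

Definition line a (b : R) : set (plane R) := [set x | dot a x = b].

(* Polygons are two-dimensional: points and segments are excluded by the
   nonempty interior. *)
Definition polygon P : Prop :=
  [/\ exists (m : nat) (a : 'I_m -> plane R) (b : 'I_m -> R),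
        (forall i, a i != 0) /\ P = \bigcap_(i in setT) halfplane (a i) (b i),
      bounded_set P
    & interior P !=set0].

(* A side is a whole edge: the intersection of P with a supporting line, when
   it is not reduced to a vertex. *)
Definition side P S : Prop :=
  exists a (b : R),
    [/\ a != 0, P `<=` halfplane a b, S = P `&` line a b
      & exists x y, [/\ S x, S y & x != y]].

Definition polygon_with_sides (m : nat) P : Prop :=
  polygon P /\ ([set S | side P S] #= `I_m)%card.

Definition line_through_origin L : Prop :=
  exists v, v != 0 /\ L = [set c *: v | c in [set: R]].

Definition parallel S L : Prop := forall x y, S x -> S y -> L (x - y).

Definition k_directional (k : nat) P : Prop :=
  polygon P /\
  exists L : 'I_k -> set (plane R),
    [/\ injective L, forall i, line_through_origin (L i)
      & forall S, side P S -> exists i, parallel S (L i)].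

Definition homothetic P Q : Prop :=
  exists (s : R) t, 0 < s /\ Q = [set s *: x + t | x in P].

End Polygons.

Section Graphs.
Context {V : finType}.

Definition intersection_graph {T : Type} (e : rel V) (Q : V -> set T) : Prop :=
  forall u v, e u v <-> u != v /\ Q u `&` Q v !=set0.

Definition clique (e : rel V) (A : {set V}) : bool :=
  [forall u in A, forall v in A, (u != v) ==> e u v].

Definition nb_maximal_cliques (e : rel V) : nat :=
  #|[set A : {set V} | maxset (clique e) A]|.

(* The sets Q v are required to be pairwise distinct; since they are compact, a
   repeated set can be slightly enlarged, so the class of graphs is the same. *)
Definition hom_graph {R : realType} (P : set (plane R)) (e : rel V) : Prop :=
  exists Q : V -> set (plane R),
    [/\ injective Q, forall v, homothetic P (Q v) & intersection_graph e Q].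

End Graphs.

(* Main.v *)
(* Only translates of P are used.  The 2k sides of P split into k pairs of
   opposite sides; let u_i be the vector joining the midpoints of the i-th pair.
   For small d, place translates of P at (1/2 + d j) u_i and (-1/2 + d j) u_i.
   Two translates of different directions meet, because the midpoint of a
   segment joining two non-parallel sides is interior to P, whereas the j-th
   "+" and the j'-th "-" translates of direction i are separated by the strip
   containing P exactly when j > j'.  Hence the pairs of index f(i), i < k, form
   a clique for every choice of f, and no clique contains two of these cliques:
   this gives (n / 2k)^k maximal cliques. *)
Require Import Defs.
From HB Require Import structures.
From mathcomp Require Import all_boot all_order all_algebra.
From mathcomp Require Import all_classical all_reals all_analysis.
From mathcomp Require Import zify ring lra.

Set Implicit Arguments.
Unset Strict Implicit.
Unset Printing Implicit Defensive.

Import Order.TTheory GRing.Theory Num.Theory.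
Import numFieldNormedType.Exports.

Local Open Scope classical_set_scope.
Local Open Scope ring_scope.

(** * Normal vectors in the plane and pairs of opposite sides *)

Section PlaneGeometry.
Context {R : realType}.
Implicit Types (P S : set (plane R)) (a b c d v x y : plane R).

Definition cross a b : R := a 0 0 * b 0 1 - a 0 1 * b 0 0.

Definition rot v : plane R := \row_j (if j == 0 then - v 0 1 else v 0 0).

Lemma dotE a x : dot a x = a 0 0 * x 0 0 + a 0 1 * x 0 1.
Proof.
rewrite /dot !big_ord_recl big_ord0 addr0.
by congr (_ + a 0 _ * x 0 _); apply/val_inj.
Qed.

Lemma plane_eq a b : a 0 0 = b 0 0 -> a 0 1 = b 0 1 -> a = b.
Proof.
move=> e0 e1; apply/rowP => j; case: (eqVneq j 0) => [-> //|j0].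
have -> // : j = 1 by apply/val_inj; case: j j0 => [[|[|]]].
Qed.

Lemma plane_neq0 a : a != 0 -> 0 < a 0 0 ^+ 2 + a 0 1 ^+ 2.
Proof.
move=> a0; rewrite lt_def addr_ge0 ?sqr_ge0 // andbT.
apply: contra a0; rewrite paddr_eq0 ?sqr_ge0 // !sqrf_eq0.
move=> /andP[/eqP e0 /eqP e1].
by apply/eqP/plane_eq; rewrite ?e0 ?e1 mxE.
Qed.

Lemma dotD a x y : dot a (x + y) = dot a x + dot a y.
Proof. by rewrite !dotE !mxE; ring. Qed.

Lemma dotB a x y : dot a (x - y) = dot a x - dot a y.
Proof. by rewrite !dotE !mxE; ring. Qed.

Lemma dotZ a (r : R) x : dot a (r *: x) = r * dot a x.
Proof. by rewrite !dotE !mxE; ring. Qed.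

Lemma dotZl a (r : R) x : dot (r *: a) x = r * dot a x.
Proof. by rewrite !dotE !mxE; ring. Qed.

Lemma dot_rot v : dot (rot v) v = 0.
Proof. by rewrite dotE !mxE /=; ring. Qed.

Lemma cross_rot v w : cross (rot v) (rot w) = cross v w.
Proof. by rewrite /cross !mxE /=; ring. Qed.

(** [v] and its quarter turn [rot v] form an orthogonal basis; the witness is the coordinate of [a]
    along [rot v]. *)
Lemma orthogonal_rot a v : v != 0 -> dot a v = 0 ->
  exists r : R, a = r *: rot v.
Proof.
move=> /plane_neq0 v0; rewrite dotE => av.
exists ((a 0 1 * v 0 0 - a 0 0 * v 0 1) / (v 0 0 ^+ 2 + v 0 1 ^+ 2)).
apply: plane_eq; rewrite !mxE /=; apply: (mulIf (lt0r_neq0 v0));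
  rewrite mulrAC divfK ?lt0r_neq0 //.
- have -> : a 0 0 * (v 0 0 ^+ 2 + v 0 1 ^+ 2) =
    (a 0 0 * v 0 0 + a 0 1 * v 0 1) * v 0 0
    + (a 0 1 * v 0 0 - a 0 0 * v 0 1) * - v 0 1 by ring.
  by rewrite av mul0r add0r.
- have -> : a 0 1 * (v 0 0 ^+ 2 + v 0 1 ^+ 2) =
    (a 0 0 * v 0 0 + a 0 1 * v 0 1) * v 0 1
    + (a 0 1 * v 0 0 - a 0 0 * v 0 1) * v 0 0 by ring.
  by rewrite av mul0r add0r.
Qed.

Lemma cross_eq0P v w : v != 0 -> cross v w = 0 -> exists r : R, w = r *: v.
Proof.
move=> /plane_neq0 v0; rewrite /cross => vw.
exists ((v 0 0 * w 0 0 + v 0 1 * w 0 1) / (v 0 0 ^+ 2 + v 0 1 ^+ 2)).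
apply: plane_eq; rewrite !mxE /=; apply: (mulIf (lt0r_neq0 v0));
  rewrite mulrAC divfK ?lt0r_neq0 //.
- have -> : w 0 0 * (v 0 0 ^+ 2 + v 0 1 ^+ 2) =
    (v 0 0 * w 0 0 + v 0 1 * w 0 1) * v 0 0
    - (v 0 0 * w 0 1 - v 0 1 * w 0 0) * v 0 1 by ring.
  by rewrite vw mul0r subr0.
- have -> : w 0 1 * (v 0 0 ^+ 2 + v 0 1 ^+ 2) =
    (v 0 0 * w 0 0 + v 0 1 * w 0 1) * v 0 1
    + (v 0 0 * w 0 1 - v 0 1 * w 0 0) * v 0 0 by ring.
  by rewrite vw mul0r addr0.
Qed.

Lemma cross_orthogonal a b d : d != 0 -> dot a d = 0 -> dot b d = 0 ->
  cross a b = 0.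
Proof.
move=> d0 /(orthogonal_rot d0)[r ->] /(orthogonal_rot d0)[s ->].
by rewrite /cross !mxE; ring.
Qed.

Lemma cross_trans a b c : c != 0 -> cross c a = 0 -> cross c b = 0 ->
  cross a b = 0.
Proof.
move=> c0 /(cross_eq0P c0)[r ->] /(cross_eq0P c0)[s ->].
by rewrite /cross !mxE; ring.
Qed.

(** The direction of a side fixes its normal up to a scalar. Dividing by the absolute value of this
    scalar leaves only a sign [s], so a side can be indexed by a direction and a sign. *)
Lemma side_normal P S v : v != 0 -> side P S ->
  parallel S [set r *: v | r in [set: R]] ->
  exists (s : bool) (b : R) x y,
    [/\ P `<=` halfplane ((-1) ^+ s *: rot v) b,
        S = P `&` line ((-1) ^+ s *: rot v) b,
        S x, S y & x != y /\ dot (rot v) (x - y) = 0].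
Proof.
move=> v0 [a [b [a0 Pab SE [x [y [Sx Sy xy]]]]]] Sv.
have [r _ rE] := Sv _ _ Sx Sy.
have r0 : r != 0.
  by apply: contra xy => /eqP r0; rewrite -subr_eq0 -rE r0 scale0r.
have av : dot a v = 0.
  apply: (mulfI r0); rewrite -dotZ rE mulr0 dotB.
  by move: Sx Sy; rewrite SE => -[_ ->] [_ ->]; rewrite subrr.
have [l aE] := orthogonal_rot v0 av.
have l0 : l != 0 by apply: contra a0 => /eqP l0; rewrite aE l0 scale0r.
have nl0 : 0 < `|l| by rewrite normr_gt0.
have dE z : dot a z = `|l| * dot ((-1) ^+ (l < 0)%R *: rot v) z.
  rewrite aE [in LHS](numEsign l) !dotZl.
  by rewrite mulrCA mulrA.
exists (l < 0), (b / `|l|), x, y; split=> //.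
- by move=> z /Pab; rewrite /halfplane /= dE mulrC -ler_pdivlMr.
- rewrite SE; congr (_ `&` _); apply/seteqP; split=> z; rewrite /line /= dE.
    by move=> <-; rewrite mulrAC divff ?mul1r ?lt0r_neq0.
  by move=> ->; rewrite mulrC divfK// lt0r_neq0.
- by split=> //; rewrite -rE dotZ dot_rot mulr0.
Qed.

(** Each side is sent to its direction and the sign of its outer normal. This map is injective
    between two sets of size [2 * k], hence bijective, so every direction has a side of each
    sign. *)
Lemma opposite_sides (k : nat) P :
  polygon_with_sides (2 * k) P -> k_directional k P ->
  exists (a : 'I_k -> plane R) (x y : 'I_k -> bool -> plane R),
    [/\ forall i l, i != l -> cross (a i) (a l) != 0,
        forall i s, [/\ P (x i s), P (y i s), x i s != y i s
                      & dot (a i) (x i s - y i s) = 0],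
        forall i z, P z ->
          dot (a i) (x i false) <= dot (a i) z <= dot (a i) (x i true)
      & forall i, dot (a i) (x i false) < dot (a i) (x i true)].
Proof.
move=> [_ cardS] [_ [L [Linj Lline Lside]]].
have [v vP] := choice Lline.
have /card_set_bijP[S [Sside Sinj _]] : (`I_(2 * k) #= [set S | side P S])%card.
  by rewrite card_eq_sym.
have normal (r : 'I_(2 * k)) : exists g : 'I_k * bool, exists (b : R) x y,
    [/\ P `<=` halfplane ((-1) ^+ g.2 *: rot (v g.1)) b,
        S r = P `&` line ((-1) ^+ g.2 *: rot (v g.1)) b,
        S r x, S r y & x != y /\ dot (rot (v g.1)) (x - y) = 0].
  have sSr : side P (S r) by apply: Sside; exact: ltn_ord.
  have [i iP] := Lside _ sSr; have [vi0 Li] := vP i; rewrite Li in iP.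
  have [s [b [x [y H]]]] := side_normal vi0 sSr iP.
  by exists (i, s), b, x, y.
have [g gP] := choice normal.
(* Two supporting lines with the same outer normal have the same offset, so they cut out the same
   side. *)
have ginj : injective g.
  move=> r r' gr; apply/val_inj/Sinj; rewrite ?inE //=.
  have [b [x [y [Pb Sb Sx _ _]]]] := gP r.
  have [b' [x' [y' [Pb' Sb' Sx' _ _]]]] := gP r'.
  rewrite -gr in Pb' Sb'; rewrite Sb Sb'; suff -> : b = b' by [].
  apply/eqP; rewrite eq_le.
  move: Sx Sx'; rewrite Sb Sb' => -[Px bx] [Px' bx'].
  move: (Pb _ Px') (Pb' _ Px); rewrite /halfplane /=.
  by rewrite bx bx' => -> ->.
have gbij : bijective g.
  by apply: inj_card_bij => //; rewrite card_prod card_bool !card_ord mulnC.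
have [h hK gK] := gbij.
have ends (j : 'I_k * bool) : exists xy : plane R * plane R,
    [/\ P xy.1 /\ P xy.2, xy.1 != xy.2, dot (rot (v j.1)) (xy.1 - xy.2) = 0,
      S (h j) = P `&` line ((-1) ^+ j.2 *: rot (v j.1))
                          (dot ((-1) ^+ j.2 *: rot (v j.1)) xy.1)
      & P `<=` halfplane ((-1) ^+ j.2 *: rot (v j.1))
                          (dot ((-1) ^+ j.2 *: rot (v j.1)) xy.1)].
  have [b [x [y]]] := gP (h j); rewrite gK => -[Pb Sb Sx Sy [xy dxy]].
  exists (x, y); rewrite /=.
  by move: Sx Sy; rewrite Sb => -[Px bx] [Py _]; rewrite bx; split.
have [xy xyP] := choice ends.
(* Sign [true] means outer normal [- rot (v i)], hence a minimum of the form; the negation makes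
   index [true] the maximum. *)
exists (fun i => rot (v i)), (fun i s => (xy (i, ~~ s)).1),
  (fun i s => (xy (i, ~~ s)).2).
have bounds i z : P z -> dot (rot (v i)) (xy (i, true)).1 <= dot (rot (v i)) z
    <= dot (rot (v i)) (xy (i, false)).1.
  move=> Pz; have [_ _ _ _ /(_ _ Pz)] := xyP (i, false).
  have [_ _ _ _ /(_ _ Pz)] := xyP (i, true).
  rewrite /halfplane /= !dotZl expr0 expr1 !mul1r !mulN1r lerN2.
  by move=> -> ->.
split=> //.
- move=> i l; apply: contra => /eqP; rewrite cross_rot => vil.
  have [vi0 Li] := vP i; have [vl0 Ll] := vP l; apply/eqP/Linj.
  have [r rE] := cross_eq0P vi0 vil.
  have r0 : r != 0 by apply: contra vl0 => /eqP r0; rewrite rE r0 scale0r.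
  rewrite Li Ll; apply/seteqP; split=> _ [c _ <-].
    by exists (c / r) => //; rewrite rE scalerA divfK.
  by exists (c * r) => //; rewrite rE scalerA.
- by move=> i s; have [[Px Py] neq0 dot0 _ _] := xyP (i, ~~ s); split.
- move=> i; have [[Px _] _ _ Sf _] := xyP (i, false).
  have [_ _ _ St _] := xyP (i, true).
  have /andP[le1 _] := bounds i _ Px; rewrite lt_neqAle le1 andbT /=.
  (* With equal values the two supporting lines coincide, so a single side would have both signs. *)
  apply/eqP => eqb.
  have : h (i, false) = h (i, true).
    apply/val_inj/Sinj; rewrite ?inE //= St Sf /= expr0 expr1.
    congr (_ `&` _); apply/seteqP; split=> z; rewrite /line /= !dotZl.
      by rewrite !mulN1r !mul1r eqb => ->.
    by rewrite !mulN1r !mul1r eqb => /oppr_inj.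
  by move/(can_inj gK).
Qed.

End PlaneGeometry.

(** * Families of translates of a polygon *)

Section Translates.
Context {R : realType}.
Implicit Types (P : set (plane R)) (a c t x y : plane R).

Definition translates_meet P t t' : Prop :=
  exists x y, [/\ P x, P y & x + t = y + t'].

Lemma translates_meetC P t t' :
  translates_meet P t t' -> translates_meet P t' t.
Proof. by move=> [x [y [Px Py xy]]]; exists y, x. Qed.

(** Otherwise [P] is stable under the nonzero vector [t - t'], and iterating this translation
    contradicts boundedness. *)
Lemma translate_inj P t t' : bounded_set P -> P !=set0 ->
  [set x + t | x in P] = [set x + t' | x in P] -> t = t'.
Proof.
move=> [M0 [_ /(_ (M0 + 1))]]; rewrite ltrDl ltr01 => /(_ isT).
set M := M0 + 1 => PM [x0 Px0] tE.
apply/eqP; rewrite -subr_eq0; apply/negPn/negP => d0.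
set d := t - t' in d0.
have Pd x : P x -> P (x + d).
  move=> Px; have : [set x + t' | x in P] (x + t) by rewrite -tE; exists x.
  by move=> [y Py yx]; rewrite /d addrA -yx addrK.
have Pn n : P (x0 + d *+ n).
  by elim: n => [|n IHn]; rewrite ?addr0 // mulrSr addrA; exact: Pd.
have nd0 : 0 < `|d| by rewrite normr_gt0.
have [n] : exists n : nat, (M + `|x0|) / `|d| < n%:R.
  exists (Num.bound ((M + `|x0|) / `|d|)); apply: archi_boundP.
  apply: divr_ge0 => //; apply: addr_ge0 => //.
  exact: le_trans (normr_ge0 _) (PM _ Px0).
rewrite ltr_pdivrMr // mulr_natl -normrMn => lt_n.
have := le_trans (ler_normB (x0 + d *+ n) x0) (lerD (PM _ (Pn n)) (lexx _)).
by rewrite [x0 + _]addrC addrK leNgt lt_n.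
Qed.

(** The inverse of [1 + C] plus the sum of all ratios [K z / F z] satisfies these finitely many
    constraints at once. *)
Lemma small_scale (T : finType) (A : pred T) (F K : T -> R) (C : R) :
  0 <= C -> (forall z, A z -> 0 < F z) -> (forall z, 0 <= K z) ->
  exists d : R, [/\ 0 < d, d * C < 1 & forall z, A z -> d * K z <= F z].
Proof.
move=> C0 F0 K0; pose S := \sum_(z | A z) K z / F z.
have S0 z : A z -> 0 <= K z / F z by move=> Az; rewrite divr_ge0 ?K0 ?ltW ?F0.
have S1 : 0 <= S by apply: sumr_ge0 => z; exact: S0.
have D0 : 0 < 1 + C + S by lra.
exists (1 + C + S)^-1; split; rewrite ?invr_gt0 //.
  by rewrite mulrC ltr_pdivrMr // mul1r; lra.
move=> z Az; rewrite mulrC ler_pdivrMr // -ler_pdivrMl ?F0 // mulrC.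
have -> : S = K z / F z + \sum_(y | A y && (y != z)) K y / F y.
  by rewrite /S (bigD1 z).
have : 0 <= \sum_(y | A y && (y != z)) K y / F y.
  by apply: sumr_ge0 => y /andP[/S0].
lra.
Qed.

(** A linear form that reaches its bound at the midpoint reaches it at both ends, so [c], like [a],
    is orthogonal to [x - y]. *)
Lemma midpoint_tight P a c (beta : R) x y :
  P x -> P y -> x != y -> dot a (x - y) = 0 ->
  (forall z, P z -> dot c z <= beta) ->
  dot c (2^-1 *: (x + y)) = beta -> cross c a = 0.
Proof.
move=> Px Py xy axy Pc; rewrite dotZ dotD => mid.
apply: (@cross_orthogonal _ _ _ (x - y)) => //; first by rewrite subr_eq0.
by rewrite dotB; have := Pc _ Px; have := Pc _ Py; lra.
Qed.

Lemma polygon_midpoint P x y : polygon P -> P x -> P y -> P (2^-1 *: (x + y)).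
Proof.
move=> [[m [A [b [_ ->]]]] _ _] Px Py i _.
have := Px i I; have := Py i I; rewrite /halfplane /= dotZ dotD; lra.
Qed.

(** The arguments of [t] are a direction, a sign and a step. The clauses serve the graph: distinct
    vertices, the two kinds of edges inside a clique, and the non-edges that keep cliques from
    merging. *)
Lemma translate_family (k n : nat) P :
  polygon_with_sides (2 * k) P -> k_directional k P ->
  exists t : 'I_k -> bool -> nat -> plane R,
    [/\ forall i s j i' s' j', (j < n)%N -> (j' < n)%N ->
          t i s j = t i' s' j' -> [/\ i = i', s = s' & j = j'],
        forall i l s s' j j', i != l -> (j < n)%N -> (j' < n)%N ->
          translates_meet P (t i s j) (t l s' j'),
        forall i j, translates_meet P (t i true j) (t i false j)
      & forall i j j', (j' < j)%N ->
          ~ translates_meet P (t i true j) (t i false j')].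
Proof.
move=> Psides Pdir; have Ppoly : polygon P by case: Psides.
have [a [x [y [across Pxy bounds width]]]] := opposite_sides Psides Pdir.
have [[m [A [b [A0 PE]]]] _ _] := Ppoly.
pose p i s := 2^-1 *: (x i s + y i s).
pose u i := p i true - p i false.
have Pp i s : P (p i s).
  by case: (Pxy i s) => Px Py _ _; exact: polygon_midpoint.
have ap i s : dot (a i) (p i s) = dot (a i) (x i s).
  by case: (Pxy i s) => _ _ _; rewrite dotB dotZ dotD; lra.
have w_gt0 i : 0 < dot (a i) (u i) by rewrite dotB !ap subr_gt0.
have PA (c : 'I_m) z : P z -> dot (A c) z <= b c by rewrite PE => /(_ c I).
have tight i s c beta : (forall z, P z -> dot c z <= beta) ->
    dot c (p i s) = beta -> cross c (a i) = 0.
  by move=> Pc; case: (Pxy i s) => Px Py xy axy; exact: midpoint_tight Pc.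
have uE i : u i = p i true - p i false by [].
clearbody u; clearbody p.
(* A constraint tight at the midpoint of [p i s] and [p l s'] is tight at both, so its normal is
   parallel to [a i] and to [a l], which are not parallel. *)
have strict (c : 'I_m) i l s s' : i != l ->
    0 < b c - (dot (A c) (p i s) + dot (A c) (p l s')) / 2.
  move=> il; rewrite subr_gt0 lt_neqAle; apply/andP; split; last first.
    by have := PA c _ (Pp i s); have := PA c _ (Pp l s'); lra.
  apply: contra (across _ _ il) => /eqP eqb; apply/eqP.
  apply: (cross_trans (A0 c)).
    apply: (tight i s _ (b c)); first exact: PA.
    by have := PA c _ (Pp i s); have := PA c _ (Pp l s'); lra.
  apply: (tight l s' _ (b c)); first exact: PA.
  by have := PA c _ (Pp i s); have := PA c _ (Pp l s'); lra.
have inside i l s : i != l ->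
    dot (a i) (x i false) < dot (a i) (p l s) < dot (a i) (x i true).
  move=> il; have /andP[lo hi] := bounds i _ (Pp l s).
  apply/andP; split; rewrite lt_neqAle ?lo ?hi andbT;
    apply: contra (across _ _ il) => /eqP E; apply/eqP.
    suff : cross (-1 *: a i) (a l) = 0.
      by rewrite /cross !mxE !mulN1r; lra.
    apply: (tight l s _ (- dot (a i) (x i false))).
      move=> z /(bounds i) /andP[+ _].
      by rewrite dotZl mulN1r lerN2.
    by rewrite dotZl mulN1r E.
  apply: (tight l s _ (dot (a i) (x i true))) => //.
  by move=> z /(bounds i) /andP[].
(* The bound [2 * n] keeps every shift [d * j] below 1/2; the other constraints keep a point moved
   by such shifts within its slack in each half-plane. *)
have [d [d0 dn dK]] := @small_scale ('I_m * ('I_k * bool) * ('I_k * bool))%type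
  (fun z => z.1.2.1 != z.2.1)
  (fun z => b z.1.1 - (dot (A z.1.1) (p z.1.2.1 z.1.2.2)
                       + dot (A z.1.1) (p z.2.1 z.2.2)) / 2)
  (fun z => n%:R * (`|dot (A z.1.1) (u z.1.2.1)| + `|dot (A z.1.1) (u z.2.1)|))
  (2 * n%:R) (mulr_ge0 (ler0n R 2) (ler0n R n))
  (fun z => strict z.1.1 z.1.2.1 z.2.1 z.1.2.2 z.2.2)
  (fun z => mulr_ge0 (ler0n R n) (addr_ge0 (normr_ge0 _) (normr_ge0 _))).
pose sg s : R := if s then 2^-1 else - 2^-1.
exists (fun i s j => (sg s + d * j%:R) *: u i).
have dj j : (j < n)%N -> 0 <= d * j%:R < 2^-1.
  move=> jn; rewrite mulr_ge0 ?ler0n ?ltW //=.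
  have : d * j%:R <= d * n%:R by rewrite ler_pM2l // ler_nat ltnW.
  by lra.
have sg_neq0 s j : (j < n)%N -> sg s + d * j%:R != 0.
  move=> /dj /andP[j0 j1]; rewrite /sg; case: s.
    by apply: lt0r_neq0; lra.
  by apply: ltr0_neq0; lra.
split.
- move=> i s j i' s' j' jn j'n tE.
  have [ii'|ii'] := eqVneq i i'.
    subst i'; have := congr1 (dot (a i)) tE; rewrite !dotZ.
    move=> /(mulIf (lt0r_neq0 (w_gt0 i))).
    have /andP[j0 j1] := dj _ jn; have /andP[j0' j1'] := dj _ j'n.
    rewrite /sg; case: s {tE}; case: s' => E;
      [ | exfalso; clear PE; lra | exfalso; clear PE; lra | ];
      have /(mulfI (lt0r_neq0 d0))/eqP : d * j%:R = d * j'%:R by lra.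
      by rewrite eqr_nat => /eqP ->.
    by rewrite eqr_nat => /eqP ->.
  (* Measured by [a i1], [u i2] is strictly shorter than [u i1], since its ends lie strictly inside
     the strip. Using this in both orders gives a contradiction. *)
  have lt_norm i1 i2 (r1 r2 : R) : i1 != i2 -> r2 != 0 ->
      r1 *: u i1 = r2 *: u i2 -> `|r1| < `|r2|.
    move=> i12 r2n0 /(congr1 (dot (a i1))); rewrite !dotZ => /(congr1 Num.norm).
    rewrite !normrM (gtr0_norm (w_gt0 _)) => E.
    rewrite -(ltr_pM2r (w_gt0 i1)) E ltr_pM2l ?normr_gt0 //.
    rewrite !uE !dotB !ap ltr_norml.
    have /andP[] := inside _ _ true i12; have /andP[] := inside _ _ false i12.
    by move=> ? ? ? ?; apply/andP; split; lra.
  have := lt_norm _ _ _ _ ii' (sg_neq0 _ _ j'n) tE.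
  rewrite eq_sym in ii'.
  by rewrite ltNge ltW // (lt_norm _ _ _ _ ii' (sg_neq0 _ _ jn) (esym tE)).
- move=> i l s s' j j' il jn j'n.
  (* At step 0 both translates contain the midpoint of [p i s] and [p l s']. The whole displacement
     due to [j] and [j'] is put on the second point, where [strict] leaves room. *)
  exists (2^-1 *: (p i (~~ s) + p l s')),
    (2^-1 *: (p i s + p l (~~ s')) + d *: (j%:R *: u i - j'%:R *: u l)).
  split; first exact: polygon_midpoint.
    rewrite PE => c _; rewrite /halfplane /= dotD !dotZ dotD dotB !dotZ.
    have /= := dK (c, (i, s), (l, ~~ s')) il.
    have : d * (j%:R * dot (A c) (u i) - j'%:R * dot (A c) (u l)) <=
           d * (n%:R * (`|dot (A c) (u i)| + `|dot (A c) (u l)|)).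
      rewrite ler_pM2l // mulrDr; apply: lerD.
        apply: (le_trans (ler_norm _)); rewrite normrM normr_nat.
        by rewrite ler_wpM2r ?normr_ge0 // ler_nat ltnW.
      apply: (le_trans (ler_norm _)); rewrite normrN normrM normr_nat.
      by rewrite ler_wpM2r ?normr_ge0 // ler_nat ltnW.
    by lra.
  rewrite !uE /sg.
  by case: s; case: s'; apply: plane_eq; rewrite !mxE /=; field.
(* At equal steps the translation vectors differ by exactly [u i], which carries [p i false] to
   [p i true]. *)
- move=> i j; exists (p i false), (p i true); split=> //.
  by rewrite uE /sg; apply: plane_eq; rewrite !mxE /=; field.
(* A common point would give two points of [P] whose values under [a i] differ by more than the
   width of the strip. *)
- move=> i j j' jj' [z [z' [/(bounds i)/andP[lo _] /(bounds i)/andP[_ hi]]]].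
  move=> /(congr1 (dot (a i))); rewrite !dotD !dotZ /sg => E.
  have : 0 < (d * j%:R - d * j'%:R) * dot (a i) (u i).
    by rewrite mulr_gt0 // subr_gt0 ltr_pM2l // ltr_nat.
  have : dot (a i) (u i) = dot (a i) (x i true) - dot (a i) (x i false).
    by rewrite uE dotB !ap.
  move: (dot (a i) (u i)) E => w E wE; lra.
Qed.

End Translates.

(** * Counting maximal cliques *)

Lemma cliqueP (V : finType) (e : rel V) (A : {set V}) :
  reflect (forall u v, u \in A -> v \in A -> u != v -> e u v) (clique e A).
Proof.
apply: (iffP forall_inP) => [Ae u v uA vA|Ae u uA].
  by have /forall_inP/(_ v vA)/implyP := Ae u uA.
by apply/forall_inP => v vA; apply/implyP; exact: Ae.
Qed.

Lemma clique_subset (V : finType) (e : rel V) (A B : {set V}) :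
  A \subset B -> clique e B -> clique e A.
Proof.
move=> /fintype.subsetP AB /cliqueP Be.
by apply/cliqueP => u v /AB uB /AB vB; exact: Be.
Qed.

(** Each [A x] extends to a maximal clique. If two extensions coincide, they contain the union,
    which is then a clique. *)
Lemma leq_nb_maximal_cliques (V T : finType) (e : rel V) (A : T -> {set V}) :
  (forall x, clique e (A x)) ->
  (forall x y, clique e (A x :|: A y) -> x = y) ->
  (#|T| <= nb_maximal_cliques e)%N.
Proof.
move=> Ae Ainj; pose B x := sval (maxset_exists (Ae x)).
have BP x : maxset (clique e) (B x) /\ A x \subset B x.
  by rewrite /B; case: (maxset_exists _).
have Binj : injective B.
  move=> x y Bxy; apply: Ainj; apply: (@clique_subset _ _ _ (B x)).
    have [_ Ax] := BP x; have [_ Ay] := BP y.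
    by rewrite finset.subUset Ax Bxy Ay.
  by have [/maxsetp] := BP x.
rewrite -(card_imset _ Binj); apply: subset_leq_card.
by apply/fintype.subsetP => _ /imsetP[x _ ->]; rewrite inE; have [] := BP x.
Qed.

(** * The intersection graph of the translates *)

Section Graphs.
Context {R : realType}.
Implicit Type P : set (plane R).

Definition translates_graph (V : finType) P (t : V -> plane R) : rel V :=
  fun u v => (u != v) && `[< translates_meet P (t u) (t v) >].

Lemma hom_translates_graph (V : finType) P (t : V -> plane R) :
  polygon P -> injective t -> hom_graph P (translates_graph P t).
Proof.
move=> [_ Pb [z0 /nbhs_singleton Pz0]] tinj.
have P0 : P !=set0 by exists z0.
exists (fun v => [set x + t v | x in P]); split.
- by move=> u v /(translate_inj Pb P0) /tinj.
- move=> v; exists 1, (t v); split=> //.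
  by apply: eq_imagel => x _; rewrite scale1r.
- move=> u v; rewrite /translates_graph; split.
    move=> /andP[-> /asboolP[x [y [Px Py xy]]]]; split=> //.
    by exists (x + t u); split; [exists x|exists y].
  move=> [-> [_ [[x Px <-] [y Py yx]]]]; apply/asboolP.
  by exists x, y.
Qed.

Lemma graph_many_cliques (k n : nat) P :
  polygon_with_sides (2 * k) P -> k_directional k P ->
  exists e : rel 'I_n,
    hom_graph P e /\ ((n %/ (2 * k)) ^ k <= nb_maximal_cliques e)%N.
Proof.
move=> Psides Pdir; have Ppoly : polygon P by case: Psides.
case: k Psides Pdir => [|k] Psides Pdir.
  (* For [k = 0] the bound is 1: the empty clique suffices, and the translation vectors need only be
     distinct. *)
  pose t (v : 'I_n) : plane R := const_mx (v%:R).
  exists (translates_graph P t); split.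
    apply: hom_translates_graph => // v w /(congr1 (fun x : plane R => x 0 0)).
    by rewrite !mxE => /eqP; rewrite eqr_nat => /eqP/val_inj.
  rewrite expn0 -card_unit.
  apply: (@leq_nb_maximal_cliques _ _ _ (fun=> finset.set0)); last by do 2 case.
  by move=> _; apply/cliqueP => u v; rewrite inE.
have [t [tinj tmeet tmeet2 tdisj]] := translate_family n Psides Pdir.
(* Mixed-radix reading of the vertex number: [v = s + 2 * (j * k.+1 + i)]. *)
pose i (v : 'I_n) : 'I_k.+1 := Ordinal (ltn_pmod v./2 (ltn0Sn k)).
pose s (v : 'I_n) := odd v.
pose j (v : 'I_n) := (v./2 %/ k.+1)%N.
have jn v : (j v < n)%N.
  by apply: leq_ltn_trans (ltn_ord v); apply: (leq_trans (leq_div _ _)); lia.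
have codeK v w : i v = i w -> s v = s w -> j v = j w -> v = w.
  move=> /(congr1 val) /= iE sE jE; apply/val_inj.
  rewrite /= -[LHS]odd_double_half.
  rewrite -[RHS]odd_double_half (divn_eq v./2 k.+1) (divn_eq w./2 k.+1).
  by rewrite iE -/(j v) -/(j w) jE -/(s v) -/(s w) sE.
set m := (n %/ _)%N.
(* Every step below [m] occurs with every direction and sign, because the codes involved are below
   [m * (2 * k.+1) <= n]. *)
have code i0 s0 (j0 : 'I_m) : exists v, [/\ i v = i0, s v = s0 & j v = j0].
  have mn : (m * (2 * k.+1) <= n)%N by exact: leq_divM.
  have vn : (s0 + (j0 * k.+1 + i0).*2 < n)%N.
    have := ltn_ord i0; have := ltn_ord j0.
    have := leq_b1 s0; move: (nat_of_ord i0) (nat_of_ord j0) => i1 j1; nia.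
  exists (Ordinal vn).
  have h : (s0 + (j0 * k.+1 + i0).*2)./2 = (j0 * k.+1 + i0)%N.
    by rewrite half_bit_double.
  split; rewrite /i /s /j.
  - by apply/val_inj; rewrite /= h modnMDl modn_small.
  - by rewrite /= oddD odd_double addbF oddb.
  - by rewrite /= h divnMDl // divn_small // addn0.
exists (translates_graph P (fun v => t (i v) (s v) (j v))); split.
  apply: hom_translates_graph => // v w /tinj [] //; exact: codeK.
have -> : (m ^ k.+1)%N = #|{ffun 'I_k.+1 -> 'I_m}|.
  by rewrite card_ffun !card_ord.
apply: (@leq_nb_maximal_cliques _ _ _
  (fun f : {ffun 'I_k.+1 -> 'I_m} => finset (fun v => j v == f (i v)))).
  move=> f; apply/cliqueP => v w; rewrite !inE => /eqP jv /eqP jw vw.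
  rewrite /translates_graph vw /=; apply/asboolP.
  have [ivw|] := eqVneq (i v) (i w); last by move=> ?; apply: tmeet.
  have jvw : j v = j w by rewrite jv jw ivw.
  have : s v != s w by apply: contra vw => /eqP svw; apply/eqP/codeK.
  rewrite ivw jvw; case: (s v); case: (s w) => // _.
  by apply: translates_meetC.
move=> f g /cliqueP fg; apply/ffunP => i0; apply/val_inj.
(* If [j2 < j1], the union would contain the [true] translate of step [j1] and the [false] translate
   of step [j2], which are disjoint. *)
have le (j1 j2 : 'I_m) : j1 \in [:: f i0; g i0] -> j2 \in [:: f i0; g i0] ->
    (j1 <= j2)%N.
  move=> j1P j2P; rewrite leqNgt; apply/negP => j21.
  have [v [iv sv jv]] := code i0 true j1.
  have [w [iw sw jw]] := code i0 false j2.
  have vw : v != w by apply: contra_eq_neq sv => ->; rewrite sw.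
  have : translates_graph P (fun v => t (i v) (s v) (j v)) v w.
    apply: fg => //; rewrite !inE ?iv ?iw ?jv ?jw.
      by move: j1P; rewrite !inE => /orP[] /eqP ->; rewrite eqxx ?orbT.
    by move: j2P; rewrite !inE => /orP[] /eqP ->; rewrite eqxx ?orbT.
  rewrite /translates_graph vw iv sv jv iw sw jw => /asboolP.
  exact: tdisj.
by apply/eqP; rewrite eqn_leq !le ?inE ?eqxx ?orbT.
Qed.

End Graphs.

(** * Asymptotic bounds *)

(** Rounding down a number that is at least 1 loses at most half of it. *)
Lemma ler_nat_divn (R : realType) (n k : nat) : (0 < k)%N -> (2 * k <= n)%N ->
  n%:R / (4 * k)%:R <= (n %/ (2 * k))%:R :> R.
Proof.
move=> k0 kn; rewrite ler_pdivrMr ?ltr0n ?muln_gt0 // -natrM ler_nat.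
have k2 : (0 < 2 * k)%N by rewrite muln_gt0.
have := ltn_ceil n k2; rewrite -(divn_gt0 n k2) in kn.
move: (n %/ _)%N kn => m m0; nia.
Qed.

(* G P n is the n-vertex graph associated with P.  In the first bound k may
   grow with n: the implied constant c depends on eps only, and n is large
   compared with a polynomial in k whose degree depends on eps only.  In the
   second bound the implied constant depends on k. *)
Theorem theorem5 (R : realType) :
  exists G : set (plane R) -> forall n : nat, rel 'I_n,
    [/\ forall (k : nat) (P : set (plane R)) (n : nat),
          polygon_with_sides (2 * k) P -> k_directional k P ->
          hom_graph P (G P n),
        forall eps : R, 0 < eps ->
          exists (c : R) (N : nat), 0 < c /\
            forall (k : nat) (P : set (plane R)) (n : nat),
              polygon_with_sides (2 * k) P -> k_directional k P ->
              (N * k ^ N <= n)%N ->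
              c * n%:R `^ (k%:R * (1 - eps)) <= (nb_maximal_cliques (G P n))%:R
      & forall k : nat,
          exists (c : R) (N : nat), 0 < c /\
            forall (P : set (plane R)) (n : nat),
              polygon_with_sides (2 * k) P -> k_directional k P ->
              (N <= n)%N ->
              c * n%:R ^+ k <= (nb_maximal_cliques (G P n))%:R].
Proof.
(* The graph must depend on [P] and [n] alone; this is possible because the number of sides of [P]
   determines [k]. *)
have ex_graph (P : set (plane R)) n : exists e : rel 'I_n, forall k,
    polygon_with_sides (2 * k) P -> k_directional k P ->
    hom_graph P e /\ ((n %/ (2 * k)) ^ k <= nb_maximal_cliques e)%N.
  have [[k [Pk Pd]]|no_k] := pselect (exists k,
    polygon_with_sides (2 * k) P /\ k_directional k P); last first.
    by exists (fun _ _ => false) => k Pk Pd; case: no_k; exists k.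
  have [e eP] := graph_many_cliques n Pk Pd.
  exists e => k' [_ Pk'] _.
  suff -> : k' = k by [].
  case: Pk => _; rewrite (card_eql Pk') => /card_eq_II /eqP.
  by rewrite eqn_mul2l /= => /eqP.
pose G (P : set (plane R)) n := sval (cid (ex_graph P n)).
have GP P n := svalP (cid (ex_graph P n)).
exists G; split.
- by move=> k P n Pk Pd; have [] := GP P n k Pk Pd.
- move=> eps eps0.
  have [M M1] : exists M : nat, eps^-1 < M%:R.
    by exists (Num.bound eps^-1); apply: archi_boundP; rewrite invr_ge0 ltW.
  have Meps : 1 <= eps * M%:R by rewrite -ler_pdivrMl // mulr1 ltW.
  (* [4 ^ M] serves as a factor and, being larger than [M], as an exponent: the hypothesis on [n]
     yields [(4 * k) ^ M <= n] for positive [k]. *)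
  exists 1, (4 ^ M)%N; split=> // k P n Pk Pd Nn; rewrite mul1r.
  have [_ /=] := GP P n k Pk Pd.
  case: k Pk Pd Nn => [|k] Pk Pd Nn.
    by rewrite mul0r powRr0 -(ler_nat R).
  rewrite -(ler_nat R); apply: le_trans; rewrite natrX.
  have M0 : (0 < M)%N.
    by rewrite lt0n; apply: contraTneq Meps => ->; rewrite mulr0 ler10.
  have Mn : ((4 * k.+1) ^ M <= n)%N.
    apply: leq_trans Nn; rewrite expnMn leq_mul2l leq_pexp2l ?orbT //.
    by rewrite ltnW // ltn_expl.
  have n4k : (4 * k.+1 <= n)%N.
    by apply: leq_trans Mn; rewrite -{1}[(4 * _)%N]expn1 leq_pexp2l.
  have n0 : 0 < n%:R :> R by rewrite ltr0n; apply: leq_trans n4k.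
  rewrite mulrC powRrM powR_mulrn ?powR_ge0 //.
  apply: lerXn2r; rewrite ?nnegrE ?powR_ge0 ?ler0n //.
  apply: le_trans (ler_nat_divn R _ _) => //; last by lia.
  rewrite powRB ?(lt0r_neq0 n0) ?implybT // powRr1 ?(ltW n0) //.
  rewrite ler_pM2l // lef_pV2 ?posrE ?powR_gt0 ?ltr0n //; last first.
    by rewrite -(ltr0n R).
  (* Since [M * eps >= 1], this bounds [4 * k.+1] by [n] to the power [eps], so dividing [n] by it
     leaves at least [n] to the power [1 - eps]. *)
  have : ((4 * k.+1) ^ M)%:R `^ eps <= n%:R `^ eps :> R.
    by apply: ge0_ler_powR; rewrite ?nnegrE ?ler0n ?ler_nat // ltW.
  apply: le_trans; rewrite natrX -powR_mulrn ?ler0n // -powRrM.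
  rewrite -[leLHS]powRr1 ?ler0n //; apply: ler_powR; rewrite ?ler1n //.
  by rewrite mulrC.
(* Each of the [k] factors costs [4 * k]; for [k = 0] the constant is an empty product, equal to
   1. *)
- move=> k; exists ((4 * k)%:R^-1 ^+ k), (4 * k)%N; split.
    case: k => [|k]; first by rewrite expr0.
    by rewrite exprn_gt0 // invr_gt0 ltr0n.
  move=> P n Pk Pd Nn; have [_ /=] := GP P n k Pk Pd.
  rewrite -(ler_nat R); apply: le_trans; rewrite natrX -exprMn.
  case: k Pk Pd Nn => [|k] Pk Pd Nn; first by rewrite !expr0.
  apply: lerXn2r; rewrite ?nnegrE ?mulr_ge0 ?invr_ge0 ?ler0n //.
  by rewrite mulrC ler_nat_divn //; lia.
Qed.
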